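(* Let $c$ be a real number with $0<c<1$. Then there exists a natural number $n(c)$ such that for every prime number $\ell$ and every prime power $q$ with $\ell\mid q-1$, $$n(c)\leqslant q\leqslant c\,\ell^2\implies \mathscr{E}(q,\ell)\neq\varnothing .$$
   Context: Let $\ell$ be a prime number and $q$ a prime power with $\ell\mid q-1$; $\mathbb{F}_q$ is the finite field with $q$ elements. For $A,B\in\mathbb{F}_q^\times$, let $N_{q,\ell}(A,B)$ be the number of $\mathbb{F}_q$-rational points on the projective plane curve $Ax^\ell+By^\ell=z^\ell$ in $\mathbb{P}^2_{\mathbb{F}_q}$, i.e. the number of points $[x:y:z]\in\mathbb{P}^2(\mathbb{F}_q)$ satisfying this equation. Define $$\mathscr{E}(q,\ell):=\{(A,B)\in\mathbb{F}_q^\times\times\mathbb{F}_q^\times : N_{q,\ell}(A,B)=0\}.$$ *)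

(* Defs.v *)
From mathcomp Require Import all_boot all_order all_algebra.
From mathcomp Require Import reals.

Set Implicit Arguments.
Unset Strict Implicit.
Unset Printing Implicit Defensive.

Import GRing.Theory.
Local Open Scope ring_scope.

Definition prime_power (q : nat) : Prop :=
  exists p k : nat, [/\ prime p, (0 < k)%N & q = (p ^ k)%N].

Section ProjectivePlane.
Variable F : finFieldType.

(* The point [x : y : z] is encoded as the set of all its representatives,
   i.e. the orbit of (x, y, z) under scaling by nonzero elements of F. *)
Definition proj_point (v : 'rV[F]_3) : {set 'rV[F]_3} :=
  [set a *: v | a : F & a != 0].

Definition proj_plane : {set {set 'rV[F]_3}} :=
  [set proj_point v | v : 'rV[F]_3 & v != 0].

End ProjectivePlane.

Section FermatCurve.
Variables (F : finFieldType) (l : nat).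

Definition on_curve (A B : F) (v : 'rV[F]_3) : bool :=
  let x := v 0 (inord 0) in
  let y := v 0 (inord 1) in
  let z := v 0 (inord 2) in
  A * x ^+ l + B * y ^+ l == z ^+ l.

(* Hence "some" or "all" representatives is immaterial in curve_points. *)
Lemma on_curveZ (A B a : F) (v : 'rV[F]_3) :
  a != 0 -> on_curve A B (a *: v) = on_curve A B v.
Proof.
move=> a0; rewrite /on_curve !mxE !exprMn (mulrCA A) (mulrCA B) -mulrDr.
by rewrite (inj_eq (mulfI _)) // expf_neq0.
Qed.

Definition curve_points (A B : F) : {set {set 'rV[F]_3}} :=
  [set P in proj_plane F | [forall v in P, on_curve A B v]].

Definition Npoints (A B : F) : nat := #|curve_points A B|.

Definition Eset : {set F * F} :=
  [set AB | [&& AB.1 != 0, AB.2 != 0 & Npoints AB.1 AB.2 == 0%N]].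

End FermatCurve.

(* Main.v *)
Require Import Defs.
From mathcomp Require Import all_boot all_order all_algebra all_field.
From mathcomp Require Import reals.
From mathcomp Require Import ring lra.
Import Order.TTheory.
Import GRing.Theory Num.Theory.
Local Open Scope ring_scope.

(** Write q - 1 = n * l.  The group H of nonzero l-th powers of a field with q
    elements has at most n elements ([card_power_units]), and whether the curve
    A x^l + B y^l = z^l has a point depends only on the classes of A and B
    modulo H.  Dividing the equation by one of its nonzero terms shows that a
    pair (A, B) whose curve has a point lies in one of four small sets
    ([bad_pair_cover]): B is in H (points with x = 0), A is in H (y = 0), A is
    in - B H (z = 0), or A is in a H and B in (1 - a) H for some a (x, y, z all
    nonzero).  The first three have at most (q - 1) n elements each, the last
    at most (q - 1) n^2, so all of them together cannot exhaust the
    (q - 1)^2 = (q - 1) n l pairs when n + 3 < l ([Eset_neq0]).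

    If q <= c l^2 then n < c l, so n + 3 < l follows from 3 <= (1 - c) l; and
    since q <= l^2, this holds once q is at least (3 / (1 - c))^2. *)

Section Counting.
Variables (F : finFieldType) (l : nat).

Definition power_units : {set F} := [set x ^+ l | x in [set~ 0]].

Lemma expf_power_units (x : F) : x != 0 -> x ^+ l \in power_units.
Proof. by move=> x0; apply: imset_f; rewrite !inE. Qed.

(** Since x^(n l) = x^(q - 1) = 1 for x nonzero, the l-th powers are roots of
    X^n - 1. *)
Lemma card_power_units (n : nat) :
  (0 < n)%N -> #|F|.-1 = (n * l)%N -> (#|power_units| <= n)%N.
Proof.
move=> n0 Fnl; rewrite cardE; apply: max_unity_roots => //; last first.
  exact: enum_uniq.
apply/allP => h; rewrite mem_enum => /imsetP[x]; rewrite !inE => x0 ->.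
apply/unity_rootP; rewrite -exprM mulnC -Fnl.
apply: (mulfI x0); rewrite mulr1 -exprS prednK ?expf_card //.
exact: ltnW (finNzRing_gt1 F).
Qed.

Lemma curve_points_solution (A B : F) :
  Npoints l A B != 0%N ->
  exists x y z : F,
    ~~ [&& x == 0, y == 0 & z == 0] /\ A * x ^+ l + B * y ^+ l = z ^+ l.
Proof.
rewrite /Npoints cards_eq0 => /set0Pn[P]; rewrite inE => /andP[].
move=> /imsetP[v]; rewrite inE => v0 -> /forall_inP/(_ v) vP.
exists (v 0 (inord 0)), (v 0 (inord 1)), (v 0 (inord 2)); split; last first.
  apply/eqP/vP/imsetP; exists 1; last by rewrite scale1r.
  by rewrite inE oner_neq0.
apply: contra v0 => /and3P[/eqP v0 /eqP v1 /eqP v2].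
apply/eqP/rowP => i; rewrite mxE -[i]inord_val.
by case: i => [[|[|[|]]]].
Qed.

(** The four families covering the pairs whose curve has a point with,
    in order, x = 0, y = 0, z = 0, and no zero coordinate. *)
Definition bad_pairs : {set F * F} :=
  setX [set~ 0] power_units :|: setX power_units [set~ 0]
  :|: [set (- u.1 * u.2, u.1) | u in setX [set~ 0] power_units]
  :|: [set (u.1 * u.2.1, (1 - u.1) * u.2.2)
        | u in setX [set~ 0] (setX power_units power_units)].

Lemma bad_pair_cover (A B : F) : (0 < l)%N ->
  A != 0 -> B != 0 -> Npoints l A B != 0%N -> (A, B) \in bad_pairs.
Proof.
move=> l0 A0 B0 /curve_points_solution[x [y [z [nz eq_xyz]]]].
have zero_pow : (0 : F) ^+ l = 0 by rewrite expr0n -[l]prednK.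
rewrite !inE /=.
have [x0|x0] := eqVneq x 0.
  have y0 : y != 0.
    apply: contra nz => /eqP y0; move: eq_xyz.
    rewrite x0 y0 zero_pow !mulr0 addr0 => /esym/eqP.
    by rewrite expf_eq0 l0 /= eqxx => ->.
  have z0 : z != 0.
    apply/eqP => z0; move/eqP: eq_xyz; rewrite x0 z0 zero_pow mulr0 add0r.
    by rewrite mulf_eq0 (negPf B0) expf_eq0 (negPf y0) andbF.
  have -> : B = (z / y) ^+ l.
    rewrite expr_div_n -eq_xyz x0 zero_pow mulr0 add0r mulfK //.
    by rewrite expf_neq0.
  by rewrite expf_power_units ?A0 // mulf_neq0 ?invr_neq0.
have [y0|y0] := eqVneq y 0.
  have z0 : z != 0.
    apply/eqP => z0; move/eqP: eq_xyz; rewrite y0 z0 zero_pow mulr0 addr0.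
    by rewrite mulf_eq0 (negPf A0) expf_eq0 (negPf x0) andbF.
  have -> : A = (z / x) ^+ l.
    rewrite expr_div_n -eq_xyz y0 zero_pow mulr0 addr0 mulfK //.
    by rewrite expf_neq0.
  by rewrite expf_power_units ?B0 ?orbT // mulf_neq0 ?invr_neq0.
have [z0|z0] := eqVneq z 0.
  apply/orP; left; apply/orP; right; apply/imsetP.
  exists (B, (y / x) ^+ l).
    by rewrite !inE /= B0 expf_power_units // mulf_neq0 ?invr_neq0.
  congr (_, _) => /=; rewrite expr_div_n mulrA mulNr.
  move/eqP: eq_xyz; rewrite z0 zero_pow addr_eq0 => /eqP <-.
  by rewrite mulfK // expf_neq0.
(* Dividing by z^l gives a + (1 - a) = 1 with a = A (x / z)^l and
   1 - a = B (y / z)^l. *)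
apply/orP; right; apply/imsetP.
exists (A * (x / z) ^+ l, ((z / x) ^+ l, (z / y) ^+ l)).
  by rewrite !inE /= !mulf_neq0 ?expf_neq0 ?expf_power_units ?mulf_neq0
    ?invr_neq0.
rewrite /= !expr_div_n.
have xl0 : x ^+ l != 0 by rewrite expf_neq0.
have yl0 : y ^+ l != 0 by rewrite expf_neq0.
have zl0 : z ^+ l != 0 by rewrite expf_neq0.
congr (_, _); first by field; rewrite xl0 zl0.
have -> : 1 - A * (x ^+ l / z ^+ l) = B * (y ^+ l / z ^+ l).
  by rewrite -(divff zl0) -[X in X / _ - _]eq_xyz; ring.
by field; rewrite yl0 zl0.
Qed.

Lemma card_bad_pairs :
  (#|bad_pairs| <= #|F|.-1 * #|power_units| * (#|power_units| + 3))%N.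
Proof.
rewrite /bad_pairs; apply: leq_trans (leq_card_setU _ _) _.
have -> m n : (m * n * (n + 3) = m * n + n * m + m * n + m * (n * n))%N by ring.
apply: leq_add; last first.
  by apply: leq_trans (leq_imset_card _ _) _; rewrite !cardsX cardsC1.
apply: leq_trans (leq_card_setU _ _) _; apply: leq_add; last first.
  by apply: leq_trans (leq_imset_card _ _) _; rewrite !cardsX cardsC1.
by apply: leq_trans (leq_card_setU _ _) _; rewrite !cardsX cardsC1.
Qed.

Lemma Eset_neq0 (n : nat) :
  #|F|.-1 = (n * l)%N -> (n + 3 < l)%N -> Eset F l != set0.
Proof.
move=> Fnl nl; have l0 : (0 < l)%N by apply: leq_ltn_trans nl.
have F1 : (0 < #|F|.-1)%N by have := finNzRing_gt1 F; case: #|F| => [|[]].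
have n0 : (0 < n)%N by move: F1; rewrite Fnl muln_gt0 => /andP[].
have Hn : (#|power_units| <= n)%N by exact: card_power_units.
apply/negP => /eqP E0.
have sub : setX [set~ (0 : F)] [set~ (0 : F)] \subset bad_pairs.
  apply/subsetP => -[A B] /setXP[]; rewrite !in_setC1 => A0 B0.
  apply: bad_pair_cover => //; apply/negP => N0.
  have : (A, B) \in Eset F l by rewrite inE /= A0 B0.
  by rewrite E0 inE.
have := leq_trans (subset_leq_card sub) card_bad_pairs.
rewrite cardsX cardsC1 -mulnA leq_pmul2l // {1}Fnl leqNgt => /negP; apply.
apply: leq_ltn_trans (_ : (n * (n + 3) < _)%N); last by rewrite ltn_pmul2l.
by rewrite leq_mul // leq_add2r.
Qed.

End Counting.

(** The two bounds on q = n l + 1 act separately: q <= c l^2 gives n < c l,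
    while the lower bound, compared with q <= l^2, makes the gap (1 - c) l
    between c l and l at least 3. *)
Lemma cofactor_bound (R : realFieldType) (c : R) (l n : nat) :
  0 < c -> c < 1 -> (0 < l)%N ->
  (3 / (1 - c)) ^+ 2 <= (n * l).+1%:R -> (n * l).+1%:R <= c * l%:R ^+ 2 ->
  (n + 3 < l)%N.
Proof.
move=> c0 c1 l0 Nq qc.
have lR0 : 0 < l%:R :> R by rewrite ltr0n.
have d0 : 0 < 1 - c by rewrite subr_gt0.
have l_ge : 3 <= (1 - c) * l%:R.
  rewrite mulrC -ler_pdivrMr // -(@ler_pXn2r _ 2) ?nnegrE //; last first.
    by rewrite divr_ge0 // ltW.
  apply: le_trans Nq (le_trans qc _).
  by rewrite ler_piMl ?ltW // exprn_gt0.
have n_lt : n%:R < c * l%:R.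
  rewrite -(ltr_pM2r lR0) -mulrA -expr2 -natrM.
  by apply: lt_le_trans qc; rewrite ltr_nat.
by rewrite -(ltr_nat R) natrD; lra.
Qed.

Theorem proposition2 (R : realType) (c : R) (hc0 : 0 < c) (hc1 : c < 1) :
  exists n : nat,
    forall l q : nat,
      prime l -> prime_power q -> (l %| q - 1)%N ->
      (n <= q)%N -> q%:R <= c * l%:R ^+ 2 ->
      forall F : finFieldType, #|F| = q -> Eset F l != set0.
Proof.
have bound_ge0 : 0 <= (3 / (1 - c)) ^+ 2 by rewrite sqr_ge0.
exists (Num.bound ((3 / (1 - c)) ^+ 2)).
move=> l q l_prime _ /dvdnP[n qnl] Nq qc F Fq.
have q0 : (0 < q)%N by rewrite -Fq; exact: ltnW (finNzRing_gt1 F).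
have q_eq : q = (n * l).+1 by rewrite -qnl subn1 prednK.
apply: (@Eset_neq0 F l n); first by rewrite Fq q_eq.
apply: (cofactor_bound _ c) => //; first exact: prime_gt0.
  rewrite -q_eq.
  by apply: le_trans (ltW (archi_boundP bound_ge0)) _; rewrite ler_nat.
by rewrite -q_eq.
Qed.
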